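(* Let $m\ge1$ be an integer and $\delta>-m$. Let $\rho_{m,\delta}$ be the unique root in $(0,1)$ of $h(z)=2\left[1-\frac{m+\delta}{2m+\delta}z\right]^m-z-1$. Run the greedy matching algorithm on the preferential attachment process $\{G_{m,\delta}(t)\}$, let $X(t)$ be the number of vertices of $[t]$ not covered by the matching $M(t)$, and $x(t)=X(t)/t$. Then for any $\alpha<1/3$, almost surely $$\lim_{t\to\infty}t^{\alpha}\max\{0,x(t)-\rho_{m,\delta}\}=0.$$ In consequence, the greedy matching algorithm almost surely finds a sequence of nested matchings $\{M(t)\}$ with $M(t)$ of size at least $(1-o(1))(1-\rho_{m,\delta})t/2$ (i.e. the number of vertices covered by $M(t)$ is asymptotically at least $(1-\rho_{m,\delta})t$).
   Context: Preferential attachment process $\{G_{m,\delta}(t)\}_{t\ge1}$ (integer $m\ge1$, real $\delta\ge -m$): $G_{m,\delta}(1)$ is vertex $1$ with $m$ loops (a loop contributes $2$ to the degree). For $t\ge 1$, $G_{m,\delta}(t+1)$ is obtained by adding vertex $t+1$ and $m$ edges from it, one at a time: for $i=1,\dots,m$, with $d_{t,i-1}(x)$ the degree of $x$ just before the $i$-th edge of $t+1$ is added (so $d_{t,0}(t+1)=0$), the other endpoint $w$ of the $i$-th edge satisfies $\mathbb P(w=x)=\frac{d_{t,i-1}(x)+\delta}{(2m+\delta)t+2i-1+i\delta/m}$ for $x\in[t]$ and $\mathbb P(w=t+1)=\frac{d_{t,i-1}(t+1)+1+i\delta/m}{(2m+\delta)t+2i-1+i\delta/m}$ (a loop). Greedy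 matching algorithm: $M(1)=\emptyset$; given the matching $M(t)$ on $[t]$, if vertex $t+1$ attaches by one of its edges to some vertex $u\in[t]$ not covered by $M(t)$ (if there are several, one such $u$ is chosen arbitrarily), set $M(t+1)=M(t)\cup\{\{u,t+1\}\}$; otherwise $M(t+1)=M(t)$. *)

(* Defs.v *)
From mathcomp Require Export all_boot all_order all_algebra finmap.
From mathcomp Require Export all_classical all_reals all_analysis.

Set Implicit Arguments.
Unset Strict Implicit.
Unset Printing Implicit Defensive.

Export Order.TTheory GRing.Theory Num.Theory.
Export numFieldNormedType.Exports.

Local Open Scope classical_set_scope.
Local Open Scope ring_scope.

(* A multigraph on the positive integers is its list of edges; (v, v) is a
   loop and contributes 2 to the degree of v. *)
Definition multigraph := seq (nat * nat).

Definition deg (g : multigraph) (x : nat) : nat :=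
  (\sum_(a <- g) ((a.1 == x) + (a.2 == x)))%N.

(* [e s j] is the other endpoint of the j-th edge (1 <= j <= m) added with
   vertex s >= 1.  [pa_graph m e t k] is the graph on all edges added with
   vertices 1, ..., t together with the first k edges added with vertex t+1;
   in particular [pa_graph m e t 0] is G(t). *)
Definition pa_graph (m : nat) (e : nat -> nat -> nat) (t k : nat) : multigraph :=
  [seq (s, e s j) | s <- iota 1 t, j <- iota 1 m]
    ++ [seq (t.+1, e t.+1 j) | j <- iota 1 k].

(* Probability that the i-th edge of vertex t+1 ends at x, when g is the graph
   just before that edge is added. *)
Definition pa_prob (R : realType) (m : nat) (delta : R) (g : multigraph)
    (t i x : nat) : R :=
  let den := (2 * m%:R + delta) * t%:R + 2 * i%:R - 1 + i%:R * delta / m%:R in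
  if (1 <= x <= t)%N then ((deg g x)%:R + delta) / den
  else if x == t.+1 then ((deg g x)%:R + 1 + i%:R * delta / m%:R) / den
  else 0.

Definition filtration (d : measure_display) (T : measurableType d)
    (F : nat -> set (set T)) : Prop :=
  [/\ forall t, sigma_algebra setT (F t),
      forall t, F t `<=` measurable &
      forall s t, (s <= t)%N -> F s `<=` F t].

(* The preferential attachment process with parameters m and delta, relative to
   a filtration F: F t contains the information on the graphs up to time t, and
   possibly further (non-anticipating) information, such as the choices made by
   an algorithm run on the process.  The last clause says that, conditionally on
   F t and on the first i - 1 edges of vertex t+1, the other endpoint of the
   i-th edge has the law [pa_prob]; since the graph just before that edge is a
   discrete random variable, it is enough to condition on each of its values. *)
Definition pref_attachment (R : realType) (d : measure_display)
    (T : measurableType d) (P : probability T R) (m : nat) (delta : R)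
    (F : nat -> set (set T)) (W : nat -> nat -> T -> nat) : Prop :=
  let G t k w := pa_graph m (fun s j => W s j w) t k in
  [/\ filtration F,
      forall t s j n, (1 <= s <= t)%N -> (1 <= j <= m)%N ->
        F t [set w | W s j w = n],
      forall j w, (1 <= j <= m)%N -> W 1%N j w = 1%N &
      forall t i, (1 <= t)%N -> (1 <= i <= m)%N ->
        forall (A : set T) (g : multigraph) (x : nat), F t A ->
          P (A `&` [set w | G t i.-1 w = g] `&` [set w | W t.+1 i w = x])
          = (P (A `&` [set w | G t i.-1 w = g]) *
             (pa_prob m delta g t i x)%:E)%E].

Definition edge_set := {fset {fset nat}}.

Definition covered (M : edge_set) (v : nat) : bool :=
  has (fun a : {fset nat} => v \in a) (enum_fset M).

Definition is_matching (g : multigraph) (M : edge_set) : Prop :=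
  (forall a : {fset nat}, a \in M -> exists u v : nat,
     [/\ u != v, a = [fset u; v]%fset & ((u, v) \in g) || ((v, u) \in g)]) /\
  (forall a b : {fset nat}, a \in M -> b \in M -> a != b ->
     [disjoint a & b]%fset).

Definition candidate (m : nat) (e : nat -> nat -> nat) (t : nat) (M : edge_set)
    (u : nat) : bool :=
  [&& (1 <= u <= t)%N, ~~ covered M u & u \in [seq e t.+1 j | j <- iota 1 m]].

Definition greedy_step (m : nat) (e : nat -> nat -> nat) (t : nat)
    (M M' : edge_set) : Prop :=
  (exists2 u, candidate m e t M u & M' = ([fset u; t.+1] |` M)%fset) \/
  ((forall u, ~~ candidate m e t M u) /\ M' = M).

(* A run M of the greedy matching algorithm on the process W.  The choice among
   several candidates is unconstrained and may be randomized, but it is made at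
   time t+1, hence may not depend on later edges: M is adapted to F. *)
Definition greedy_matching (d : measure_display) (T : measurableType d)
    (m : nat) (F : nat -> set (set T)) (W : nat -> nat -> T -> nat)
    (M : nat -> T -> edge_set) : Prop :=
  [/\ forall t (S : edge_set), (1 <= t)%N -> F t [set w | M t w = S],
      forall w, M 1%N w = fset0 &
      forall w t, (1 <= t)%N ->
        greedy_step m (fun s j => W s j w) t (M t w) (M t.+1 w)].

Definition num_uncovered (M : edge_set) (t : nat) : nat :=
  count (fun v => ~~ covered M v) (iota 1 t).

Definition num_covered (M : edge_set) (t : nat) : nat :=
  count (covered M) (iota 1 t).

Definition h (R : realType) (m : nat) (delta z : R) : R :=
  2 * (1 - (m%:R + delta) / (2 * m%:R + delta) * z) ^+ m - z - 1.

(* Main.v *)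
Require Import Defs.
From mathcomp Require Import measurable_realfun ring lra zify.

Set Implicit Arguments.
Unset Strict Implicit.
Unset Printing Implicit Defensive.

Local Open Scope classical_set_scope.
Local Open Scope ring_scope.

(** Write [x t] for the fraction of uncovered vertices and [y t] for
[max 0 (x t - rho)].  An uncovered vertex has degree at least [m], so each edge
of vertex [t+1] misses the uncovered set with conditional probability at most
[1 - (m + delta) / (2m + delta) * x t + O(1/t)].  When it is missed [m] times the
number of uncovered vertices grows by one, otherwise it drops by one, so the
conditional drift of [x t] is at most [(h (x t) + O(1/t)) / (t + 1)].  As [h]
decreases with slope at most [-1], it is at most [- y t] when [x t >= rho], which
gives [E (y (t+1))^2 <= (1 - 2/(t+1)) E (y t)^2 + C/(t+1)^2] and therefore
[E (y t)^2 <= C/t].  Hence [\sum_k k^(6 alpha) (y (k^3))^2] has finite expectation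
for [alpha < 1/3], so [k^(3 alpha) y (k^3)] tends to [0] almost surely; between
[k^3] and [(k+1)^3] the quantity [y] grows by at most [7/k], which the factor
[k^(3 alpha)] does not compensate. *)

(** * The root of [h] and the one-step drift inequality *)

Section RealAnalysis.
Context {R : realType}.
Implicit Types (m n : nat) (delta rho x p c : R).

(** On the unit interval the derivative of [z ^+ m] is at most [m]. This carries the error of order
    [1/t] in [miss_bound] over to its [m]-th power. *)
Lemma exprB_le_lipschitz m (a b : R) :
  0 <= b -> b <= a -> a <= 1 -> a ^+ m - b ^+ m <= m%:R * (a - b).
Proof.
move=> b0 ba a1; elim: m => [|m IH]; first by rewrite !expr0 subrr mul0r.
have am : 0 <= a ^+ m <= 1 by rewrite exprn_ge0 ?exprn_ile1; lra.
have bm : b ^+ m <= a ^+ m by rewrite lerXn2r// nnegrE; lra.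
have bm0 : 0 <= b ^+ m by rewrite exprn_ge0.
rewrite !exprS -natr1.
have -> : a * a ^+ m - b * b ^+ m = (a - b) * a ^+ m + b * (a ^+ m - b ^+ m).
  by ring.
nra.
Qed.

Lemma attach_ratio_itv m delta : (1 <= m)%N -> - m%:R < delta ->
  0 < (m%:R + delta) / (2 * m%:R + delta) < 1.
Proof.
move=> m1 dm; have m0 : 1 <= m%:R :> R by rewrite ler1n.
by rewrite divr_gt0 ?ltr_pdivrMr /=; lra.
Qed.

(** The base of the power lies in [[0, 1]] and decreases, so the power does not increase and the
    term [- z] alone yields the slope. This serves both the uniqueness of the root and the
    contraction of the drift. *)
Lemma h_decrease m delta (x y : R) : (1 <= m)%N -> - m%:R < delta ->
  0 <= x -> x <= y -> y <= 1 -> h m delta y - h m delta x <= x - y.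
Proof.
move=> m1 dm x0 xy y1; have := attach_ratio_itv m1 dm.
rewrite /h; set c := _ / _ => /andP[c0 c1].
suff : (1 - c * y) ^+ m <= (1 - c * x) ^+ m by lra.
by rewrite lerXn2r ?nnegrE; nra.
Qed.

Lemma h_continuous m delta : continuous (h m delta : R -> R).
Proof.
move=> x; rewrite /h; apply: cvgB; last exact: cvg_cst.
apply: cvgB; last exact: cvg_id.
apply: cvgM; first exact: cvg_cst.
pose c := (m%:R + delta) / (2 * m%:R + delta).
apply: (@continuous_comp _ _ _ (fun z : R => 1 - c * z) (fun z : R => z ^+ m));
  last exact: exprn_continuous.
apply: cvgB; first exact: cvg_cst.
by apply: cvgM; [exact: cvg_cst|exact: cvg_id].
Qed.

Lemma h_unique_root m delta : (1 <= m)%N -> - m%:R < delta ->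
  exists rho : R, unique (fun z : R => 0 < z < 1 /\ h m delta z = 0) rho.
Proof.
move=> m1 dm; have /andP[c0 c1] := attach_ratio_itv m1 dm.
have h0 : h m delta 0 = 1 by rewrite /h mulr0 !subr0 expr1n; lra.
have h1 : h m delta 1 < 0.
  rewrite /h mulr1.
  suff : (1 - (m%:R + delta) / (2 * m%:R + delta)) ^+ m < 1 by lra.
  by rewrite exprn_ilt1 -?lt0n //; lra.
have [||rho] := @IVT R (h m delta) 0 1 0 ler01.
- by apply: continuous_subspaceT; exact: h_continuous.
- by rewrite h0 ge_min le_max (ltW h1) orbT ler01.
rewrite in_itv /= => /andP[r0 r1] hr.
exists rho; split.
  split=> //; rewrite !lt_neqAle r0 r1 !andbT; apply/andP; split.
    by apply/eqP => r; move: hr h0; rewrite -r => ->; lra.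
  by apply/eqP => r; move: hr h1; rewrite r => ->; lra.
move=> z [/andP[z0 z1] hz].
have [zr|zr] := leP z rho.
  have := h_decrease m1 dm (ltW z0) zr r1; lra.
have := h_decrease m1 dm r0 (ltW zr) (ltW z1); lra.
Qed.

(* A bound, uniform over the [m] edges of vertex [t+1], for the probability of
   missing [n] given vertices of [t], each of degree at least [m]. *)
Definition miss_bound m delta (t n : nat) : R :=
  1 - (m%:R + delta) * n%:R / ((2 * m%:R + delta) * t%:R + (2 * m%:R + `|delta|)).

(** The argument [x] is a number of vertices rather than a fraction; it is real so that a count
    minus one is not truncated at zero. *)
Definition excess rho (t : nat) x : R := Num.max 0 (x / t%:R - rho).

Lemma excess_ge0 rho t x : 0 <= excess rho t x.
Proof. by rewrite /excess le_max lexx. Qed.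

Lemma excess_homo rho t x x' : x <= x' -> excess rho t x <= excess rho t x'.
Proof.
move=> xx'; rewrite /excess ge_max !le_max lexx /=; apply/orP; right.
by rewrite lerB // ler_wpM2r // invr_ge0.
Qed.

Lemma sqr_excess_le rho t x : excess rho t x ^+ 2 <= (x / t%:R - rho) ^+ 2.
Proof.
rewrite /excess; case: (leP 0 (x / t%:R - rho)) => // _.
by rewrite expr0n /= sqr_ge0.
Qed.

(** The first summand comes from the error in the missing probability, the [4] from the square of
    one jump of the fraction, of size at most [2 / t.+1]. *)
Definition drift_const m delta : R :=
  8 * m%:R * ((2 * m%:R + `|delta|) / (2 * m%:R + delta)) + 4.

Lemma drift_const_ge m delta : (1 <= m)%N -> - m%:R < delta ->
  4 <= drift_const m delta.
Proof.
move=> m1 dm.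
have mR : 1 <= m%:R :> R by rewrite ler1n.
have dn : 0 <= `|delta| := normr_ge0 delta.
rewrite /drift_const lerDr; apply: mulr_ge0; first by rewrite mulr_ge0.
by apply: divr_ge0; lra.
Qed.

Lemma miss_bound_itv m delta t n : (1 <= m)%N -> - m%:R < delta ->
  (1 <= t)%N -> (n <= t)%N ->
  0 <= miss_bound m delta t n <= 1.
Proof.
move=> m1 dm t1 nt.
have mR : 1 <= m%:R :> R by rewrite ler1n.
have dn : 0 <= `|delta| := normr_ge0 delta.
have tR : 1 <= t%:R :> R by rewrite ler1n.
have ntR : n%:R <= t%:R :> R by rewrite ler_nat.
have n0 : 0 <= n%:R :> R by [].
rewrite /miss_bound subr_ge0 gerBl ler_pdivrMr ?divr_ge0 /=; nra.
Qed.

(** Dropping the constant [K] from the denominator [D + K] changes the quotient [N / D], which is at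
    most [1], by a relative amount [K / (D + K)], hence by at most [K / D]. *)
Lemma miss_bound_le m delta c t n : (1 <= m)%N -> - m%:R < delta ->
  (1 <= t)%N -> (n <= t)%N ->
  c = (m%:R + delta) / (2 * m%:R + delta) ->
  1 - c * (n%:R / t%:R) <= miss_bound m delta t n
    <= 1 - c * (n%:R / t%:R) +
       (2 * m%:R + `|delta|) / (2 * m%:R + delta) / t%:R.
Proof.
move=> m1 dm t1 nt cE.
have mR : 1 <= m%:R :> R by rewrite ler1n.
have dn : 0 <= `|delta| := normr_ge0 delta.
have tR : 1 <= t%:R :> R by rewrite ler1n.
have ntR : n%:R <= t%:R :> R by rewrite ler_nat.
have n0 : 0 <= n%:R :> R by [].
rewrite /miss_bound; set K := 2 * m%:R + `|delta|.
have K0 : 0 < K by rewrite /K; lra.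
set D := (2 * m%:R + delta) * t%:R.
have D0 : 0 < D by rewrite /D mulr_gt0; lra.
have -> : c * (n%:R / t%:R) = (m%:R + delta) * n%:R / D.
  rewrite cE /D; field; lra.
have -> : K / (2 * m%:R + delta) / t%:R = K / D by rewrite /D; field; lra.
set N := (m%:R + delta) * n%:R.
have N0 : 0 <= N by rewrite /N mulr_ge0; lra.
have ND : N <= D by rewrite /N /D; nra.
have -> : N / (D + K) = N / D - (N / D) * (K / (D + K)) by field; lra.
have q0 : 0 <= N / D <= 1 by rewrite divr_ge0 ?ler_pdivrMr; lra.
have r0 : 0 <= K / (D + K) <= K / D.
  by rewrite divr_ge0 ?ler_pM2l ?lef_pV2 ?posrE; lra.
nra.
Qed.

(** The left side is the mean squared excess after one step when an uncovered vertex is gained with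
    probability [p]. Below [rho] only the squared jump survives; above it the bound on [h] contracts
    the excess. *)
Lemma drift_le m delta rho p t n : (1 <= m)%N -> - m%:R < delta ->
  0 < rho -> rho < 1 -> h m delta rho = 0 ->
  (1 <= t)%N -> (n <= t)%N ->
  p = miss_bound m delta t n ^+ m ->
  p * excess rho t.+1 (n%:R + 1) ^+ 2 + (1 - p) * excess rho t.+1 (n%:R - 1) ^+ 2
  <= (1 - 2 / t.+1%:R) * excess rho t n%:R ^+ 2
     + drift_const m delta / t.+1%:R ^+ 2.
Proof.
move=> m1 dm r0 r1 hr t1 nt pE.
have mR : 1 <= m%:R :> R by rewrite ler1n.
have dn : 0 <= `|delta| := normr_ge0 delta.
have tR : 1 <= t%:R :> R by rewrite ler1n.
have ntR : n%:R <= t%:R :> R by rewrite ler_nat.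
have n0 : 0 <= n%:R :> R by [].
have /andP[f0 f1] := miss_bound_itv m1 dm t1 nt.
have p01 : 0 <= p <= 1 by rewrite pE exprn_ge0 ?exprn_ile1.
have C4 := drift_const_ge m1 dm.
pose S : R := t.+1%:R; have SE : S = t%:R + 1 by rewrite /S natr1.
pose x : R := n%:R / t%:R.
have x01 : 0 <= x <= 1 by rewrite /x divr_ge0 ?ler_pdivrMr; lra.
have xE : n%:R = x * t%:R by rewrite /x divfK //; lra.
rewrite -/S; set C := drift_const m delta in C4 *.
set i : R := S^-1; have i0 : 0 < i by rewrite /i invr_gt0; lra.
have iS : i * S = 1 by rewrite /i mulVf //; lra.
have [xr|xr] := ltP x rho.
  have e0 : excess rho t n%:R = 0.
    by rewrite /excess -/x; apply/max_idPl; lra.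
  have up : excess rho t.+1 (n%:R + 1) <= i.
    by rewrite /excess -/S -/i ge_max; apply/andP; split; nra.
  have lo : excess rho t.+1 (n%:R - 1) <= i.
    by apply: le_trans up; apply: excess_homo; lra.
  have := excess_ge0 rho t.+1 (n%:R + 1); have := excess_ge0 rho t.+1 (n%:R - 1).
  rewrite e0 expr0n /= mulr0 add0r -exprVn -/i => l0 u0.
  have lo2 : excess rho t.+1 (n%:R - 1) ^+ 2 <= i ^+ 2 by rewrite lerXn2r // nnegrE; lra.
  have up2 : excess rho t.+1 (n%:R + 1) ^+ 2 <= i ^+ 2 by rewrite lerXn2r // nnegrE; lra.
  have i2 : 0 <= i ^+ 2 by rewrite sqr_ge0.
  nra.
have -> : excess rho t n%:R = x - rho by rewrite /excess -/x; apply/max_idPr; lra.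
pose y := x - rho; rewrite -/y.
(* The new fraction [(n + 1) / (t + 1)] is [x + (1 - x) / (t + 1)], and the square of a positive
   part is at most the full square. *)
have up : excess rho t.+1 (n%:R + 1) ^+ 2 <= (y + (1 - x) * i) ^+ 2.
  apply: le_trans (sqr_excess_le _ _ _) _; rewrite -/S -/i.
  suff -> : (n%:R + 1) * i - rho = y + (1 - x) * i by [].
  rewrite /y xE; have -> : t%:R = S - 1 by rewrite SE; ring.
  have -> : (x * (S - 1) + 1) * i = x * (i * S) + (1 - x) * i by ring.
  rewrite iS; ring.
have lo : excess rho t.+1 (n%:R - 1) ^+ 2 <= (y - (1 + x) * i) ^+ 2.
  apply: le_trans (sqr_excess_le _ _ _) _; rewrite -/S -/i.
  suff -> : (n%:R - 1) * i - rho = y - (1 + x) * i by [].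
  rewrite /y xE; have -> : t%:R = S - 1 by rewrite SE; ring.
  have -> : (x * (S - 1) - 1) * i = x * (i * S) - (1 + x) * i by ring.
  rewrite iS; ring.
have y01 : 0 <= y <= 1 by rewrite /y; lra.
have /andP[fl fu] := miss_bound_le m1 dm t1 nt erefl.
rewrite -/x in fl fu.
have /andP[c0 c1] := attach_ratio_itv m1 dm.
have hx : h m delta x <= - y.
  have := h_decrease m1 dm (ltW r0) xr (proj2 (andP x01)).
  rewrite hr /y; lra.
have pdiff : p <= (1 - (m%:R + delta) / (2 * m%:R + delta) * x) ^+ m +
    m%:R * ((2 * m%:R + `|delta|) / (2 * m%:R + delta) / t%:R).
  rewrite -lerBlDl pE; apply: le_trans (exprB_le_lipschitz _ _ _ _) _ => //.
    by nra.
  by rewrite ler_pM2l; lra.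
rewrite /h in hx.
set g := (_ ^+ m) in hx pdiff.
set K := (2 * m%:R + `|delta|) / (2 * m%:R + delta) in pdiff.
have K0 : 0 <= K by rewrite divr_ge0; lra.
have it : (t%:R)^-1 <= 2 * i.
  have -> : t%:R^-1 = i * (S / t%:R) by rewrite /i; field; lra.
  by rewrite [leRHS]mulrC ler_pM2l // ler_pdivrMr; lra.
(* With [g] in place of [p] the left side is [h m delta x]. The factor [4] is twice the [2] lost in
   [1 / t <= 2 / t.+1]. *)
have pd : 2 * p - 1 - x <= - y + 4 * m%:R * K * i.
  have : m%:R * (K / t%:R) <= m%:R * (K * (2 * i)).
    by apply: ler_wpM2l => //; apply: ler_wpM2l.
  lra.
rewrite -exprVn -/i.
(* The cross term is the mean increment, since [p * (1 - x) - (1 - p) * (1 + x) = 2 * p - 1 - x]. *)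
have main : p * (y + (1 - x) * i) ^+ 2 + (1 - p) * (y - (1 + x) * i) ^+ 2 =
   y ^+ 2 + 2 * (y * i) * (2 * p - 1 - x) +
   (p * (1 - x) ^+ 2 + (1 - p) * (1 + x) ^+ 2) * i ^+ 2 by ring.
have step1 : p * excess rho t.+1 (n%:R + 1) ^+ 2 +
   (1 - p) * excess rho t.+1 (n%:R - 1) ^+ 2 <=
   p * (y + (1 - x) * i) ^+ 2 + (1 - p) * (y - (1 + x) * i) ^+ 2.
  by apply: lerD; apply: ler_wpM2l => //; lra.
apply: le_trans step1 _; rewrite main.
have q4 : p * (1 - x) ^+ 2 + (1 - p) * (1 + x) ^+ 2 <= 4.
  have a1 : (1 - x) ^+ 2 <= 4 by rewrite expr2; nra.
  have a2 : (1 + x) ^+ 2 <= 4 by rewrite expr2; nra.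
  by nra.
have i2 : 0 <= i ^+ 2 by rewrite sqr_ge0.
have mK : 0 <= m%:R * K by rewrite mulr_ge0.
have CE : C = 8 * (m%:R * K) + 4 by rewrite /C /drift_const -/K; ring.
have s2 : 2 * (y * i) * (2 * p - 1 - x) <=
   2 * (y * i) * (- y + 4 * m%:R * K * i).
  by apply: ler_wpM2l => //; rewrite mulr_ge0 // mulr_ge0; lra.
have s3 : (p * (1 - x) ^+ 2 + (1 - p) * (1 + x) ^+ 2) * i ^+ 2 <= 4 * i ^+ 2.
  by apply: ler_wpM2r.
have s4 : y * (m%:R * K) * i ^+ 2 <= (m%:R * K) * i ^+ 2.
  by apply: ler_wpM2r => //; apply: ler_piMl => //; lra.
rewrite CE.
apply: le_trans (lerD (lerD (lexx _) s2) s3) _.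
have -> : y ^+ 2 + 2 * (y * i) * (- y + 4 * m%:R * K * i) + 4 * i ^+ 2 =
  (1 - 2 * i) * y ^+ 2 + 8 * (y * (m%:R * K) * i ^+ 2) + 4 * i ^+ 2 by ring.
lra.
Qed.

End RealAnalysis.

(** * Sums of negative powers *)

Section PowerSums.
Context {R : realType}.
Implicit Types n : nat.

(** With [x = n.+1], division by the power [- a] of [x + 1] leaves
    [a / (x + 1) <= ((x + 1) / x) ^ a - 1], which follows from [exp z >= 1 + z] and
    [ln (1 + z) <= z]. *)
Lemma powR_telescope (a : R) n : 0 <= a ->
  a * n.+2%:R `^ (- (a + 1)) <= n.+1%:R `^ (- a) - n.+2%:R `^ (- a).
Proof.
move=> a0; set x : R := n.+1%:R; have x0 : 0 < x by rewrite /x ltr0n.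
have -> : n.+2%:R = x + 1 :> R by rewrite /x natr1.
have y0 : 0 < x + 1 by lra.
rewrite opprD powRD ?(gt_eqF y0) ?implybT //.
rewrite powR_inv1 ?(ltW y0) //.
have -> : x `^ (- a) = (x + 1) `^ (- a) * ((x + 1) / x) `^ a.
  rewrite powRM ?invr_ge0 ?ltW // mulrA -powRD ?(gt_eqF y0) ?implybT //.
  rewrite addNr powRr0 mul1r.
  by rewrite -powR_inv1 ?ltW // -powRrM mulN1r.
set b := _ `^ (- a); have b0 : 0 <= b by rewrite powR_ge0.
suff key : a * (x + 1)^-1 <= ((x + 1) / x) `^ a - 1.
  by rewrite mulrCA -[X in _ - X]mulr1 -mulrBr ler_wpM2l.
have -> : ((x + 1) / x) `^ a = expR (a * ln ((x + 1) / x)).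
  by rewrite /powR ifF // gt_eqF // divr_gt0.
have := expR_ge1Dx (a * ln ((x + 1) / x)).
have : (x + 1)^-1 <= ln ((x + 1) / x).
  rewrite -[X in ln X]invrK lnV ?posrE ?invr_gt0 ?divr_gt0 // invf_div.
  have -> : x / (x + 1) = 1 + (- (x + 1)^-1) by field; lra.
  have : ln (1 + - (x + 1)^-1) <= - (x + 1)^-1.
    by apply: le_ln1Dx; rewrite ltrN2 invf_lt1; lra.
  lra.
set l := ln _ => l1 l2.
have : a * (x + 1)^-1 <= a * l by rewrite ler_wpM2l.
lra.
Qed.

Lemma sum_powR_le (a : R) n : 0 < a ->
  \sum_(k < n) k.+1%:R `^ (- (a + 1)) <= 1 + a^-1.
Proof.
(* The induction carries the telescoped remainder of order [n.+1 ^ (- a)], which is dropped at the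
   end. *)
move=> a0; suff : forall n, \sum_(k < n.+1) k.+1%:R `^ (- (a + 1)) <=
    1 + a^-1 * (1 - n.+1%:R `^ (- a)).
  move=> H; apply: (@le_trans _ _ (\sum_(k < n.+1) k.+1%:R `^ (- (a + 1)))).
    by rewrite big_ord_recr /= lerDl powR_ge0.
  by apply: le_trans (H n) _; rewrite lerD2l ler_piMr ?invr_ge0 ?(ltW a0) //.
elim=> [|k IH]; first by rewrite big_ord1 !powR1; lra.
rewrite big_ord_recr /=; have := powR_telescope k (ltW a0).
rewrite mulrC -ler_pdivlMr // mulrC.
move: IH; move: (_ `^ _) (k.+1%:R `^ (- a)) (k.+2%:R `^ (- a)) => u v w.
rewrite !mulrBr !mulr1; lra.
Qed.

End PowerSums.

(** * Combinatorics of one run of the greedy algorithm *)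

Section GreedyRun.
Variables (m : nat) (e : nat -> nat -> nat) (M : nat -> edge_set).
Hypothesis M1 : M 1%N = fset0.
Hypothesis Mstep : forall t, (1 <= t)%N -> greedy_step m e t (M t) (M t.+1).

Lemma covered0 v : covered fset0 v = false.
Proof. by apply/negP => /hasP[a]. Qed.

Lemma covered_fset1U (S : edge_set) (a : {fset nat}) v :
  covered (a |` S)%fset v = (v \in a) || covered S v.
Proof.
apply/hasP/orP => [[b]|[va|/hasP[b bS vb]]].
- by rewrite in_fset1U => /orP[/eqP ->|bS] vb; [left|right; apply/hasP; exists b].
- by exists a; rewrite // in_fset1U eqxx.
- by exists b => //; rewrite in_fset1U bS orbT.
Qed.

(** Used for the arriving vertex: it lies in no earlier edge, and it counts as uncovered until it is
    matched. *)
Lemma greedy_covered_itv t v : (1 <= t)%N -> covered (M t) v -> (1 <= v <= t)%N.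
Proof.
elim: t => // -[|t] IH _; first by rewrite M1 covered0.
case: (Mstep (ltn0Sn t)) => [[u /and3P[ut _ _] ->]|[_ ->]].
  rewrite covered_fset1U !inE => /orP[/orP[/eqP ->|/eqP ->]|/IH]; lia.
by move=> /IH; lia.
Qed.

Lemma pa_graph_edge_subset t : {subset pa_graph m e t 0 <= pa_graph m e t.+1 0}.
Proof.
move=> a; rewrite /pa_graph !cats0 => /allpairsPdep[s [j [sI jI ->]]].
by apply/allpairsPdep; exists s, j; split=> //; move: sI; rewrite !mem_iota; lia.
Qed.

Lemma greedy_subset t : (1 <= t)%N -> (M t `<=` M t.+1)%fset.
Proof.
by move=> t1; case: (Mstep t1) => [[u _ ->]|[_ ->]]; rewrite ?fsubsetUr.
Qed.

Lemma greedy_is_matching t : (1 <= t)%N -> is_matching (pa_graph m e t 0) (M t).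
Proof.
elim: t => // -[|t] IH _; first by rewrite M1; split.
have {IH}[IHe IHd] := IH isT.
have lift a : a \in M t.+1 -> exists u v : nat, [/\ u != v,
    a = [fset u; v]%fset & ((u, v) \in pa_graph m e t.+2 0) ||
                           ((v, u) \in pa_graph m e t.+2 0)].
  move=> /IHe[u [v [uv aE /orP eG]]]; exists u, v; split => //.
  by apply/orP; case: eG => /pa_graph_edge_subset; [left|right].
case: (Mstep (ltn0Sn t)) => [[u /and3P[ut uM /mapP[j jm uE]] ->]|[_ ->]];
  last by split.
(* Neither end of the new edge lies in an old one: [u] is uncovered and [t.+2] has only just
   arrived. *)
have dis a : a \in M t.+1 -> [disjoint [fset u; t.+2] & a]%fset.
  move=> aM; apply/fdisjointP => v; rewrite !inE => /orP[/eqP ->|/eqP ->].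
    by apply: contra uM => ua; apply/hasP; exists a.
  apply/negP => ta; suff : (1 <= t.+2 <= t.+1)%N by lia.
  by apply: greedy_covered_itv => //; apply/hasP; exists a.
split=> [a|a b].
  rewrite in_fset1U => /orP[/eqP ->|/lift //]; exists u, t.+2; split => //.
    by lia.
  apply/orP; right; rewrite /pa_graph cats0; apply/allpairsPdep.
  by exists t.+2, j; split => //; [rewrite mem_iota; lia|rewrite uE].
rewrite !in_fset1U => /orP[/eqP ->|aM] /orP[/eqP ->|bM]; first by rewrite eqxx.
- by move=> _; exact: dis.
- by move=> _; rewrite fdisjoint_sym; exact: dis.
- exact: IHd.
Qed.

Lemma num_covered_uncovered (S : edge_set) t :
  (num_covered S t + num_uncovered S t)%N = t.
Proof.
rewrite /num_covered /num_uncovered.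
by rewrite (count_predC (covered S)) size_iota.
Qed.

Lemma num_uncovered_miss t : (1 <= t)%N ->
  num_uncovered (M t) t.+1 = (num_uncovered (M t) t).+1.
Proof.
move=> t1; rewrite /num_uncovered.
have -> : iota 1 t.+1 = iota 1 t ++ [:: t.+1] by rewrite -(addn1 t) iotaD addnC.
rewrite count_cat /= addn0.
case: (boolP (covered (M t) t.+1)) => [|_]; last by rewrite addn1.
by move=> /(greedy_covered_itv t1); lia.
Qed.

(** Both ends become covered: [t.+1] is the vertex appended to the range, and [u] joins the covered
    vertices without having been one of them. *)
Lemma num_covered_hit t u : (1 <= t)%N -> candidate m e t (M t) u ->
  num_covered ([fset u; t.+1] |` M t)%fset t.+1 = (num_covered (M t) t).+2.
Proof.
move=> t1 /and3P[ut uM _]; rewrite /num_covered.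
have -> : iota 1 t.+1 = iota 1 t ++ [:: t.+1] by rewrite -(addn1 t) iotaD addnC.
rewrite count_cat /= covered_fset1U !inE eqxx orbT /= addn0 addn1; congr _.+1.
have -> : count (covered ([fset u; t.+1] |` M t)%fset) (iota 1 t) =
          count (predU (pred1 u) (covered (M t))) (iota 1 t).
  apply: eq_in_count => v; rewrite mem_iota => vt /=.
  by rewrite covered_fset1U !inE (_ : (v == t.+1) = false) ?orbF //; lia.
have := count_predUI (pred1 u) (covered (M t)) (iota 1 t).
rewrite (count_uniq_mem _ (iota_uniq _ _)) mem_iota.
have -> : count (predI (pred1 u) (covered (M t))) (iota 1 t) = 0%N.
  apply/eqP; rewrite -leqn0 leqNgt -has_count; apply/hasPn => v _ /=.
  by apply/negP => /andP[/eqP -> cu]; move: uM; rewrite cu.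
by rewrite addn0 add1n ltnS ut => ->.
Qed.

Lemma num_uncovered_hit t u : (1 <= t)%N -> candidate m e t (M t) u ->
  (num_uncovered ([fset u; t.+1] |` M t)%fset t.+1).+1 = num_uncovered (M t) t.
Proof.
move=> t1 cu; have := num_covered_hit t1 cu.
have := num_covered_uncovered (M t) t.
have := num_covered_uncovered ([fset u; t.+1] |` M t)%fset t.+1.
lia.
Qed.

(** By induction along the run: a hit covers two more vertices and adds one edge, while the arriving
    vertex of a miss stays uncovered. *)
Lemma num_covered_card t : (1 <= t)%N -> num_covered (M t) t = (#|` M t|).*2.
Proof.
elim: t => // -[|t] IH _.
  by rewrite M1 cardfs0.
have {}IH := IH isT.
case: (Mstep (ltn0Sn t)) => [[u cu ->]|[_ ->]].
  rewrite (num_covered_hit _ cu) // IH cardfsU1.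
  (* Were this edge already present, [u] would be covered. *)
  suff -> : ([fset u; t.+2]%fset \notin M t.+1) by rewrite add1n doubleS.
  apply/negP => uM; case/and3P: cu => _ /negP[]; apply/hasP.
  by exists [fset u; t.+2]%fset; rewrite // !inE eqxx.
have := num_uncovered_miss (ltn0Sn t).
have := num_covered_uncovered (M t.+1) t.+1.
have := num_covered_uncovered (M t.+1) t.+2.
lia.
Qed.

Lemma num_uncovered_le (S : edge_set) t : (num_uncovered S t <= t)%N.
Proof. by rewrite /num_uncovered (leq_trans (count_size _ _)) ?size_iota. Qed.

(** A miss adds one uncovered vertex and a hit removes one. This one-sided control is what fills in
    the times between consecutive cubes. *)
Lemma num_uncovered_growth s t : (1 <= s)%N -> (s <= t)%N ->
  (num_uncovered (M t) t <= num_uncovered (M s) s + (t - s))%N.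
Proof.
move=> s1; elim: t => [|t IH]; first by lia.
rewrite leq_eqVlt => /orP[/eqP <-|]; first by lia.
rewrite ltnS => st; have t1 := leq_trans s1 st; have {}IH := IH st.
case: (Mstep t1) => [[u cu ->]|[_ ->]].
  by have := num_uncovered_hit t1 cu; lia.
by rewrite num_uncovered_miss //; lia.
Qed.

End GreedyRun.

(** * Measurability and integration through countably many values *)

Section DiscreteMeasurability.
Context {R : realType} {d : measure_display} {T : measurableType d}.

(** Graphs and matchings are given no sigma-algebra, so measurability is asked of the fibres only;
    over a countable type this gives it for all preimages. *)
Definition discrete_meas {U : Type} (f : T -> U) :=
  forall y, measurable [set w | f w = y].

Lemma discrete_meas_preimage (U : countType) (f : T -> U) (B : set U) :
  discrete_meas f -> measurable (f @^-1` B).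
Proof.
move=> mf; have -> : f @^-1` B = \bigcup_(y : U)
    ([set w | f w = y] `&` [set _ | B y]).
  by apply/seteqP; split=> [w Bw|w [y _ [<-]]] //; exists (f w).
apply: countable_bigcupT_measurable => [|y]; first exact: countableP.
have [By|By] := pselect (B y).
  by rewrite (_ : [set _ | B y] = setT) ?setIT //; apply/seteqP; split.
by rewrite (_ : [set _ | B y] = set0) ?setI0 //; apply/seteqP; split.
Qed.

Lemma discrete_meas_comp (U : countType) V (f : T -> U) (g : U -> V) :
  discrete_meas f -> discrete_meas (g \o f).
Proof. by move=> mf y; exact: (discrete_meas_preimage [set u | g u = y] mf). Qed.

Lemma discrete_meas_pair (U V : countType) (f : T -> U) (g : T -> V) :
  discrete_meas f -> discrete_meas g -> discrete_meas (fun w => (f w, g w)).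
Proof.
move=> mf mg [y z].
have -> : [set w | (f w, g w) = (y, z)] = [set w | f w = y] `&` [set w | g w = z].
  by apply/seteqP; split=> w /= [-> ->].
exact: measurableI.
Qed.

Lemma discrete_meas_cst U (c : U) : discrete_meas (fun _ : T => c).
Proof.
move=> y; have [->|cy] := pselect (c = y).
  by rewrite (_ : [set _ | _] = setT) //; apply/seteqP; split.
by rewrite (_ : [set _ | _] = set0) //; apply/seteqP; split.
Qed.

Lemma discrete_meas_cat (U : countType) (f g : T -> seq U) :
  discrete_meas f -> discrete_meas g -> discrete_meas (fun w => f w ++ g w).
Proof.
move=> mf mg.
exact: (discrete_meas_comp (fun p => p.1 ++ p.2) (discrete_meas_pair mf mg)).
Qed.

Lemma discrete_meas_flatten_map (I : eqType) (U : countType)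
    (f : I -> T -> seq U) (s : seq I) :
  (forall i, i \in s -> discrete_meas (f i)) ->
  discrete_meas (fun w => flatten [seq f i w | i <- s]).
Proof.
elim: s => [|i s IH] ms; first exact: discrete_meas_cst.
apply: discrete_meas_cat; first by apply: ms; rewrite mem_head.
by apply: IH => j js; apply: ms; rewrite in_cons js orbT.
Qed.

Lemma discrete_meas_map (I : eqType) (U : countType)
    (f : I -> T -> U) (s : seq I) :
  (forall i, i \in s -> discrete_meas (f i)) ->
  discrete_meas (fun w => [seq f i w | i <- s]).
Proof.
move=> ms; have -> : (fun w => [seq f i w | i <- s]) =
    (fun w => flatten [seq [:: f i w] | i <- s]).
  by apply/funext => w; elim: s {ms} => //= i s ->.
apply: discrete_meas_flatten_map => i /ms.
exact: (discrete_meas_comp (fun x => [:: x])).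
Qed.

Lemma discrete_meas_pa_graph (W : nat -> nat -> T -> nat) m t k :
  (forall s j, (1 <= s <= t.+1)%N -> (1 <= j <= m)%N -> discrete_meas (W s j)) ->
  (k <= m)%N ->
  discrete_meas (fun w => pa_graph m (fun s j => W s j w) t k).
Proof.
move=> mW km.
have edge s j : (1 <= s <= t.+1)%N -> (1 <= j <= m)%N ->
    discrete_meas (fun w => (s, W s j w)).
  by move=> hs hj; exact: (discrete_meas_comp (pair s) (mW s j hs hj)).
apply: discrete_meas_cat.
  apply: discrete_meas_flatten_map => s; rewrite mem_iota => hs.
  by apply: discrete_meas_map => j; rewrite mem_iota => hj; apply: edge; lia.
by apply: discrete_meas_map => j; rewrite mem_iota => hj; apply: edge; lia.
Qed.

Lemma measurable_fun_discrete (U : countType) (f : T -> U) (g : U -> \bar R) :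
  discrete_meas f -> measurable_fun setT (fun w => g (f w)).
Proof.
by move=> mf _ Y _; rewrite setTI; exact: (discrete_meas_preimage (g @^-1` Y) mf).
Qed.

(** Fibres are numbered through [pickle], so that sums over values become series; a number that
    codes no value taken has an empty fibre. *)
Let level (U : countType) (f : T -> U) (n : nat) : set T :=
  [set w | choice.pickle (f w) = n].

Let level_bigcup (U : countType) (f : T -> U) : \bigcup_n level f n = setT.
Proof. by apply/seteqP; split=> // w _; exists (choice.pickle (f w)). Qed.

Let level_triv (U : countType) (f : T -> U) : trivIset setT (level f).
Proof. by move=> i j _ _ [w [<- <-]]. Qed.

Let level_cases (U : countType) (f : T -> U) n :
  (exists y, level f n = [set w | f w = y]) \/ level f n = set0.
Proof.
have [[w0 w0n]|no] := pselect (exists w, level f n w).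
  left; exists (f w0); apply/seteqP; split=> w; rewrite /level /= -w0n.
    by move=> /(pcan_inj choice.pickleK).
  by move=> ->.
by right; apply/seteqP; split=> // w nw; apply: no; exists w.
Qed.

(** Stands in for conditional expectation given [f]: the integrals over the countably many fibres
    are compared one by one and summed. *)
Lemma integral_le_by_values (mu : {measure set T -> \bar R}) (U : countType)
    (f : T -> U) (g1 g2 : T -> \bar R) :
  discrete_meas f ->
  measurable_fun setT g1 -> measurable_fun setT g2 ->
  (forall w, 0 <= g1 w)%E -> (forall w, 0 <= g2 w)%E ->
  (forall y, \int[mu]_(w in [set w | f w = y]) g1 w <=
             \int[mu]_(w in [set w | f w = y]) g2 w)%E ->
  (\int[mu]_w g1 w <= \int[mu]_w g2 w)%E.
Proof.
move=> mf mg1 mg2 g10 g20 le12; rewrite -(level_bigcup f).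
have ml n : measurable (level f n).
  by case: (level_cases f n) => [[y ->]|->].
rewrite !ge0_integral_bigcup ?level_bigcup //; try exact: level_triv.
apply: lee_nneseries => [n _ _|n _]; first exact: integral_ge0.
by case: (level_cases f n) => [[y ->]|->]; rewrite ?integral_set0.
Qed.

(** The analogue for events, turning a bound conditional on the value of [f] into an unconditional
    one. *)
Lemma measure_le_by_values (mu : {measure set T -> \bar R}) (U : countType)
    (f : T -> U) (A B : set T) (c : R) :
  discrete_meas f -> measurable A -> measurable B -> 0 <= c ->
  (forall y, mu (A `&` [set w | f w = y]) <=
             c%:E * mu (B `&` [set w | f w = y]))%E ->
  (mu A <= c%:E * mu B)%E.
Proof.
move=> mf mA mB c0 le12.
have split_level (C : set T) : measurable C ->
    mu C = (\sum_(0 <= n <oo) mu (C `&` level f n))%E.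
  move=> mC; rewrite -{1}(setIT C) -(level_bigcup f) setI_bigcupr.
  rewrite measure_semi_bigcup //.
  - move=> n; apply: measurableI => //.
    by case: (level_cases f n) => [[y ->]|->].
  - by move=> i j _ _ [w [[_ <-] [_ <-]]].
  - apply: bigcupT_measurable => n; apply: measurableI => //.
    by case: (level_cases f n) => [[y ->]|->].
rewrite (split_level A mA) (split_level B mB) -nneseriesZl //.
apply: lee_nneseries => [n _ _ //|n _].
by case: (level_cases f n) => [[y ->]|->]; rewrite ?setI0 ?measure0 ?mule0.
Qed.

End DiscreteMeasurability.

(** * Almost sure convergence from summable expectations *)

(** The integral of the series is at most [B], so its sum is finite almost everywhere, and the terms
    of a convergent series tend to [0]. *)
Lemma ae_cvg0_summable (R : realType) (d : measure_display)
    (T : measurableType d) (mu : {measure set T -> \bar R})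
    (f : nat -> T -> R) (b : nat -> R) (B : R) :
  (forall k, measurable_fun setT (EFin \o f k)) ->
  (forall k w, 0 <= f k w) ->
  (forall k, \int[mu]_w (f k w)%:E <= (b k)%:E)%E ->
  (forall n, \sum_(k < n) b k <= B) ->
  {ae mu, forall w, (fun k => f k w) @ \oo --> (0 : R)}.
Proof.
move=> mf f0 fb bB.
pose S w := (\sum_(0 <= k <oo) (f k w)%:E)%E.
have S0 w : (0 <= S w)%E by apply: nneseries_ge0 => k _ _; rewrite lee_fin.
have mS : measurable_fun setT S.
  apply: ge0_emeasurable_sum => [k w _ _|k _]; last exact: mf.
  by rewrite lee_fin.
have Sint : mu.-integrable setT S.
  apply/integrableP; split => //.
  under eq_integral do rewrite gee0_abs //.
  rewrite integral_nneseries //; last by move=> k w _; rewrite lee_fin.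
  apply: (@le_lt_trans _ _ B%:E); last exact: ltry.
  apply: lime_le.
    by apply: is_cvg_nneseries => k _ _; apply: integral_ge0 => w _; rewrite lee_fin.
  apply: nearW => n; rewrite big_mkord.
  apply: (@le_trans _ _ (\sum_(k < n) (b k)%:E)%E); first exact: lee_sum.
  by rewrite sumEFin lee_fin.
have := integrable_ae measurableT Sint; apply: filterS => w /(_ Logic.I) Sfin.
apply: cvg_series_cvg_0; apply: nnseries_is_cvg => [k|] //.
by rewrite ltey_eq Sfin.
Qed.

(** * Probability that an arriving vertex misses a set of old vertices *)

(** Each of the [m] edges added with [x] has [x] as first endpoint; all other contributions to the
    degree are discarded. *)
Lemma deg_pa_graph_ge m e t k x : (1 <= x <= t)%N ->
  (m <= deg (pa_graph m e t k) x)%N.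
Proof.
move=> xt; rewrite /deg /pa_graph big_cat /=.
apply: leq_trans (leq_addr _ _); rewrite big_allpairs_dep /=.
rewrite (bigD1_seq x) ?iota_uniq ?mem_iota //=.
apply: leq_trans (leq_addr _ _).
rewrite -[leqLHS](size_iota 1) -sum1_size; apply: leq_sum => j _.
by rewrite eqxx.
Qed.

(** The edge list keeps the order of insertion, so the value of the graph determines the endpoints
    of the edges already added with [t.+1]. *)
Lemma pa_graph_last_edges m e e' t k : pa_graph m e t k = pa_graph m e' t k ->
  forall j, j \in iota 1 k -> e t.+1 j = e' t.+1 j.
Proof.
rewrite /pa_graph => /eqP; rewrite eqseq_cat ?size_allpairs //.
by move=> /andP[_ /eqP] /eq_in_map H j /H[].
Qed.

(** The numerator is at least [m + delta], and the part of the denominator depending on [i] is at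
    most [2 m + |delta|] because [i <= m]. *)
Lemma pa_prob_ge (R : realType) m (delta : R) g t i x :
  (1 <= m)%N -> - m%:R < delta -> (1 <= i <= m)%N -> (1 <= x <= t)%N ->
  (m <= deg g x)%N ->
  (m%:R + delta) / ((2 * m%:R + delta) * t%:R + (2 * m%:R + `|delta|))
  <= pa_prob m delta g t i x.
Proof.
move=> m1 dm /andP[i1 im] xt dx; rewrite /pa_prob xt.
have mR : 1 <= m%:R :> R by rewrite ler1n.
have iR : 1 <= i%:R :> R by rewrite ler1n.
have imR : i%:R <= m%:R :> R by rewrite ler_nat.
have tR : 1 <= t%:R :> R by rewrite ler1n; lia.
have dxR : m%:R <= (deg g x)%:R :> R by rewrite ler_nat.
have dn : 0 <= `|delta| := normr_ge0 delta.
have du := ler_norm delta.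
pose q : R := i%:R / m%:R.
have q01 : 0 <= q <= 1 by rewrite /q divr_ge0 ?ler_pdivrMr; lra.
have iq : i%:R = q * m%:R by rewrite /q divfK //; lra.
have -> : i%:R * delta / m%:R = q * delta by rewrite /q mulrAC.
have qu : q * delta <= `|delta| by nra.
(* This keeps the denominator positive when [delta] is negative. *)
have ql : - i%:R <= q * delta by rewrite iq; nra.
have D0 : 0 < (2 * m%:R + delta) * t%:R by rewrite mulr_gt0; lra.
apply: ler_pM => //; [lra|by rewrite invr_ge0; lra|lra|].
by rewrite lef_pV2 ?posrE; lra.
Qed.

Section MissProbability.
Context {R : realType} {d : measure_display} {T : measurableType d}.
Variables (P : probability T R) (m : nat) (delta : R).
Variables (F : nat -> set (set T)) (W : nat -> nat -> T -> nat).
Hypotheses (m1 : (1 <= m)%N) (dm : - m%:R < delta).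
Hypothesis PA : pref_attachment P m delta F W.

Lemma edge_discrete_meas s j : (1 <= s)%N -> (1 <= j <= m)%N ->
  discrete_meas (W s j).
Proof.
case: PA => -[_ Fm _] FW _ _ s1 jm y.
by apply: (Fm s); apply: FW; rewrite ?s1 ?leqnn.
Qed.

Lemma hit_probability t i (A : set T) g (U : seq nat) :
  (1 <= t)%N -> (1 <= i <= m)%N -> F t A -> uniq U ->
  let B := A `&` [set w | pa_graph m (fun s j => W s j w) t i.-1 = g] in
  measurable B ->
  P (B `&` [set w | W t.+1 i w \in U]) =
  (P B * (\sum_(x <- U) pa_prob m delta g t i x)%:E)%E.
Proof.
move=> t1 im FA uU B mB; elim: U uU => [_|x U IH /andP[xU uU]].
  rewrite big_nil mule0 (_ : _ `&` _ = set0) ?measure0 //.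
  by apply/seteqP; split=> // w [].
have mW (V : seq nat) : measurable [set w | W t.+1 i w \in V].
  exact: (discrete_meas_preimage [set y | y \in V] (edge_discrete_meas _ im)).
have -> : B `&` [set w | W t.+1 i w \in x :: U] =
    (B `&` [set w | W t.+1 i w = x]) `|` (B `&` [set w | W t.+1 i w \in U]).
  rewrite -setIUr; congr (_ `&` _); apply/seteqP; split=> w /=.
    by rewrite in_cons => /orP[/eqP|]; [left|right].
  by rewrite in_cons => -[->|->]; rewrite ?eqxx ?orbT.
rewrite measureU; last 3 first.
- by apply: measurableI => //; exact: edge_discrete_meas.
- by apply: measurableI => //; exact: mW.
- by apply/seteqP; split=> // w [[_ /= ->] [_ /=]]; rewrite (negbTE xU).
rewrite [X in (_ + X)%E = _](IH uU) big_cons EFinD.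
case: PA => _ _ _ /(_ t i t1 im A g x FA) PWx.
by rewrite [X in (X + _)%E = _]PWx muleDr ?fin_num_measure // fin_num_adde_defl.
Qed.

(** The edges are revealed one at a time: given the graph before it, each misses [U] with
    probability at most [miss_bound], whatever the previous edges were. The list [U] is
    deterministic; it will be read off the matching that [A] fixes. *)
Lemma miss_probability t (A : set T) (U : seq nat) :
  (1 <= t)%N -> F t A -> uniq U -> {in U, forall x, (1 <= x <= t)%N} ->
  (P (A `&` [set w | forall j, j \in iota 1 m -> W t.+1 j w \notin U]) <=
   (miss_bound m delta t (size U) ^+ m)%:E * P A)%E.
Proof.
move=> t1 FA uU Ut.
have mA : measurable A by case: PA => -[_ Fm _] _ _ _; exact: (Fm t).
have nt : (size U <= t)%N.
  rewrite -[leqRHS](size_iota 1); apply: uniq_leq_size => // x /Ut.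
  by rewrite mem_iota; lia.
have /andP[f0 f1] := miss_bound_itv m1 dm t1 nt.
set f := miss_bound _ _ _ _ in f0 f1 *.
pose miss k := A `&` [set w | forall j, j \in iota 1 k -> W t.+1 j w \notin U].
have missS k : miss k.+1 = miss k `&` [set w | W t.+1 k.+1 w \notin U].
  apply/seteqP; split=> w /=.
    move=> [Aw H]; split; last by apply: H; rewrite mem_iota; lia.
    by split=> // j jk; apply: H; move: jk; rewrite !mem_iota; lia.
  move=> [[Aw H] wk]; split=> // j; rewrite mem_iota => jk.
  have [->//|jk'] := eqVneq j k.+1.
  by apply: H; rewrite mem_iota; lia.
have mmiss k : (k <= m)%N -> measurable (miss k).
  elim: k => [_|k IH km].
    rewrite (_ : miss 0 = A) //; apply/seteqP; split=> [w []|w Aw] //.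
  rewrite missS; apply: measurableI; first by apply: IH; lia.
  apply: (discrete_meas_preimage [set y | y \notin U] (edge_discrete_meas _ _)).
    by [].
  by lia.
suff H k : (k <= m)%N -> (P (miss k) <= (f ^+ k)%:E * P A)%E by exact: H.
elim: k => [_|k IH km].
  by rewrite expr0 mul1e le_measure ?inE //; [exact: mmiss|move=> w []].
apply: (@le_trans _ _ (f%:E * P (miss k))%E); last first.
  rewrite exprS EFinM -muleA; apply: lee_wpmul2l; first by rewrite lee_fin.
  by apply: IH; lia.
have mG : discrete_meas (fun w => pa_graph m (fun s j => W s j w) t k).
  apply: discrete_meas_pa_graph => [s j st jm|]; last by lia.
  by apply: edge_discrete_meas => //; lia.
apply: (measure_le_by_values mG) => //; [by apply: mmiss|by apply: mmiss; lia|].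
move=> g; rewrite missS.
set B := A `&` [set w | pa_graph m (fun s j => W s j w) t k = g].
have mB : measurable B by apply: measurableI.
(* On a fibre of the graph the first [k] endpoints are constant, so the event of having missed [U]
   so far is either empty there or all of [B], to which the attachment law applies. *)
have [[w0 [[Aw0 Hw0] Gw0]]|no] := pselect (exists w,
    (miss k `&` [set w | pa_graph m (fun s j => W s j w) t k = g]) w); last first.
  rewrite (_ : _ `&` _ = set0) ?measure0 ?mule_ge0 ?lee_fin //.
  by apply/seteqP; split=> // w [[mw _] gw]; apply: no; exists w.
have BE : miss k `&` [set w | pa_graph m (fun s j => W s j w) t k = g] = B.
  apply/seteqP; split=> [w [[]]|w [Aw Gw]] //; split=> //; split=> // j jk.
  by rewrite (pa_graph_last_edges (etrans Gw (esym Gw0)) jk) Hw0.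
rewrite BE setIAC BE.
have im : (1 <= k.+1 <= m)%N by lia.
have hit := hit_probability t1 im FA uU mB.
have mhit : measurable (B `&` [set w | W t.+1 k.+1 w \in U]).
  apply: measurableI => //.
  exact: (discrete_meas_preimage [set y | y \in U] (edge_discrete_meas _ im)).
have -> : B `&` [set w | W t.+1 k.+1 w \notin U] =
    B `\` (B `&` [set w | W t.+1 k.+1 w \in U]).
  apply/seteqP; split=> [w [Bw /negP wU]|w [Bw wU]]; split=> //.
    by move=> [_].
  by apply/negP => wU'; apply: wU; split.
rewrite measureD //; last by rewrite ltey_eq fin_num_measure.
rewrite setIA setIid.
(* Since [g] is attained at [w0], it is an actual attachment graph, and every target in [U] has
   degree at least [m] in it. *)
have hitB : (size U)%:R * (m%:R + delta) /
    ((2 * m%:R + delta) * t%:R + (2 * m%:R + `|delta|)) <=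
    \sum_(x <- U) pa_prob m delta g t k.+1 x.
  rewrite -mulrA mulr_natl -iter_addr_0 -count_predT -big_const_seq.
  rewrite big_seq [leRHS]big_seq; apply: ler_sum => x /Ut xt.
  by apply: pa_prob_ge => //; rewrite -Gw0; exact: deg_pa_graph_ge.
have PBfin : P B \is a fin_num by exact: fin_num_measure.
have PB0 : 0 <= fine (P B) by rewrite fine_ge0.
set b := \sum_(_ <- _) _ in hitB hit.
have {}hit : P (B `&` [set w | W t.+1 k.+1 w \in U]) = (fine (P B) * b)%:E.
  by rewrite EFinM fineK.
rewrite [X in (_ - X)%E]hit -[X in (X - _)%E](fineK PBfin).
rewrite -[X in (_ * X)%E](fineK PBfin) -EFinM -EFinB lee_fin.
have -> : f = 1 - (size U)%:R * (m%:R + delta) /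
    ((2 * m%:R + delta) * t%:R + (2 * m%:R + `|delta|)).
  by rewrite /f /miss_bound [(size U)%:R * _]mulrC.
by move: hitB; set a := _ / _; nra.
Qed.

End MissProbability.

(** * Recursion for the second moment of the excess *)

Section SecondMoment.
Context {R : realType} {d : measure_display} {T : measurableType d}.
Variables (P : probability T R) (m : nat) (delta rho : R).
Variables (F : nat -> set (set T)) (W : nat -> nat -> T -> nat).
Variable M : nat -> T -> edge_set.
Hypotheses (m1 : (1 <= m)%N) (dm : - m%:R < delta).
Hypotheses (rho0 : 0 < rho) (rho1 : rho < 1) (hrho : h m delta rho = 0).
Hypothesis PA : pref_attachment P m delta F W.
Hypothesis GM : greedy_matching m F W M.

Let Y t w : R := excess rho t (num_uncovered (M t w) t)%:R.

Lemma matching_discrete_meas t : (1 <= t)%N -> discrete_meas (M t).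
Proof.
case: PA => -[_ Fm _] _ _ _; case: GM => FM _ _ t1 S.
by apply: (Fm t); exact: FM.
Qed.

Lemma measurable_excess t : (1 <= t)%N ->
  measurable_fun setT (fun w => (Y t w ^+ 2)%:E).
Proof.
move=> t1; exact: (measurable_fun_discrete
  (fun S => (excess rho t (num_uncovered S t)%:R ^+ 2)%:E)
  (matching_discrete_meas t1)).
Qed.

(** Conditioning is on the matching [M t] alone: its value determines the number of uncovered
    vertices and the set that the new edges must miss, and its fibres belong to [F t]. *)
Lemma second_moment_step t : (1 <= t)%N ->
  (\int[P]_w (Y t.+1 w ^+ 2)%:E <=
   \int[P]_w ((1 - 2 / t.+1%:R) * Y t w ^+ 2 +
              drift_const m delta / t.+1%:R ^+ 2)%:E)%E.
Proof.
move=> t1; have tR : 2 <= t.+1%:R :> R by rewrite ler_nat.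
have C4 := drift_const_ge m1 dm.
apply: (integral_le_by_values (matching_discrete_meas t1)).
- exact: measurable_excess.
- exact: (measurable_fun_discrete (fun S => ((1 - 2 / t.+1%:R) *
    excess rho t (num_uncovered S t)%:R ^+ 2 +
    drift_const m delta / t.+1%:R ^+ 2)%:E) (matching_discrete_meas t1)).
- by move=> w; rewrite lee_fin sqr_ge0.
- move=> w; rewrite lee_fin; apply: addr_ge0; last first.
    by apply: divr_ge0; [lra|exact: sqr_ge0].
  by apply: mulr_ge0; [rewrite subr_ge0 ler_pdivrMr; lra|exact: sqr_ge0].
move=> S; set A := [set w | M t w = S].
have mA : measurable A by exact: matching_discrete_meas.
set n := num_uncovered S t; have nt : (n <= t)%N by exact: num_uncovered_le.
pose U := [seq v <- iota 1 t | ~~ covered S v].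
have sU : size U = n by rewrite size_filter.
pose N := [set w | forall j, j \in iota 1 m -> W t.+1 j w \notin U].
pose a := excess rho t.+1 (n%:R + 1) ^+ 2.
pose b := excess rho t.+1 (n%:R - 1) ^+ 2.
have b0 : 0 <= b by rewrite sqr_ge0.
(* This order allows the probability of a miss to be replaced by its upper bound. *)
have ab : b <= a.
  rewrite /a /b lerXn2r ?nnegrE ?excess_ge0 //; apply: excess_homo; lra.
have mN : measurable N.
  have -> : N = \bigcap_(j in [set j | j \in iota 1 m])
      [set w | W t.+1 j w \notin U] by [].
  apply: bigcap_measurable => [|j /=].
    by exists 1%N; rewrite /= mem_iota; lia.
  rewrite mem_iota => jm.
  apply: (discrete_meas_preimage [set y | y \notin U]).
  by apply: (edge_discrete_meas PA) => //; lia.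
(* On the fibre a hit gives the value [b], while a step without candidate gives [a] and lies in
   [N]. *)
apply: (@le_trans _ _ (\int[P]_(w in A) (b%:E + (a - b)%:E * (\1_N w)%:E))%E).
  apply: ge0_le_integral => //.
  - by move=> w _; rewrite lee_fin sqr_ge0.
  - by apply: measurable_funTS; exact: measurable_excess.
  - apply: emeasurable_funD => //; apply: emeasurable_funM => //.
    by apply/measurable_EFinP; exact: measurable_indic.
  move=> w Aw; rewrite -EFinM -EFinD lee_fin.
  case: GM => _ _ /(_ w t t1); rewrite (Aw : M t w = S) => -[[u cu ME]|[nc ME]].
    suff -> : Y t.+1 w ^+ 2 = b by rewrite lerDl mulr_ge0 // subr_ge0.
    rewrite /Y /b ME /n; congr (excess _ _ _ ^+ 2).
    have := @num_uncovered_hit m (fun s j => W s j w) (M^~ w) t u t1; rewrite (Aw : M t w = S) => /(_ cu) <-.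
    by rewrite -natr1 addrK.
  rewrite indicE mem_set /=; last first.
    move=> j jm; apply/negP; rewrite mem_filter mem_iota => /andP[cW Wt].
    move: (nc (W t.+1 j w)) => /negP[]; apply/and3P; split => //.
    by apply/mapP; exists j.
  rewrite mulr1 addrC subrK /Y /a ME /n.
  have H1 : M 1%N w = fset0 by case: GM.
  have Hs s : (1 <= s)%N -> greedy_step m (fun s j => W s j w) s (M s w) (M s.+1 w).
    by case: GM => _ _; exact.
  have := @num_uncovered_miss m _ (M^~ w) H1 Hs t t1; rewrite (Aw : M t w = S) => ->.
  by rewrite natr1.
rewrite ge0_integralD //; last 2 first.
- by move=> w _; rewrite -EFinM lee_fin mulr_ge0 ?subr_ge0 // indicE.
- apply: emeasurable_funM => //.
  by apply/measurable_EFinP; exact: measurable_indic.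
rewrite integral_cst // ge0_integralZl //; last 2 first.
- by apply/measurable_EFinP; exact: measurable_indic.
- by rewrite lee_fin subr_ge0.
rewrite integral_indic // setIC.
have -> : (\int[P]_(w in A) ((1 - 2 / t.+1%:R) * Y t w ^+ 2 +
              drift_const m delta / t.+1%:R ^+ 2)%:E)%E =
   (((1 - 2 / t.+1%:R) * excess rho t n%:R ^+ 2 +
              drift_const m delta / t.+1%:R ^+ 2)%:E * P A)%E.
  rewrite -integral_cst //; apply: eq_integral => w; rewrite inE => Aw.
  by rewrite /Y (Aw : M t w = S).
have FA : F t A by case: GM => FM _ _; exact: FM.
have uU : uniq U by rewrite filter_uniq // iota_uniq.
have Ut : {in U, forall x, (1 <= x <= t)%N}.
  by move=> x; rewrite mem_filter mem_iota => /andP[_]; lia.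
have := miss_probability m1 dm PA t1 FA uU Ut; rewrite sU -/N => missP.
have := drift_le m1 dm rho0 rho1 hrho t1 nt erefl.
set p := _ ^+ m in missP *; rewrite -/a -/b => drift.
apply: (@le_trans _ _ (b%:E * P A + (a - b)%:E * (p%:E * P A))%E).
  by apply: leeD2l; apply: lee_wpmul2l => //; rewrite lee_fin subr_ge0.
have PAfin : P A \is a fin_num by exact: fin_num_measure.
rewrite -[X in (_ * X + _)%E](fineK PAfin) -[X in (_ + _ * (_ * X))%E](fineK PAfin).
rewrite -[X in (_ <= _ * X)%E](fineK PAfin) -!EFinM -EFinD lee_fin.
have -> : b * fine (P A) + (a - b) * (p * fine (P A)) =
   (p * a + (1 - p) * b) * fine (P A) by ring.
by apply: ler_wpM2r => //; rewrite fine_ge0.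
Qed.

Lemma second_moment_le t : (1 <= t)%N ->
  (\int[P]_w (Y t w ^+ 2)%:E <= (drift_const m delta / t%:R)%:E)%E.
Proof.
have C4 := drift_const_ge m1 dm; set C := drift_const m delta in C4 *.
elim: t => // -[|t] IH _.
  (* At [t = 1] the excess is at most [1], and the constant is at least [4]. *)
  apply: (@le_trans _ _ (\int[P]_w (cst 1%:E w))%E).
    apply: ge0_le_integral => //.
    - by move=> w _; rewrite lee_fin sqr_ge0.
    - exact: measurable_excess.
    move=> w _; rewrite lee_fin exprn_ile1 ?excess_ge0 // /Y /excess ge_max ler01 /=.
    rewrite divr1; have := num_uncovered_le (M 1%N w) 1; rewrite -(ler_nat R).
    by have := rho0; lra.
  by rewrite integral_cst // [X in (_ * X)%E]probability_setT mul1e divr1 lee_fin; lra.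
have {}IH := IH isT; apply: le_trans (second_moment_step _) _ => //.
set s := t.+1 in IH *; have sR : 1 <= s%:R :> R by rewrite ler1n.
have SE : s.+1%:R = s%:R + 1 :> R by rewrite natr1.
have c0 : 0 <= 1 - 2 / s.+1%:R :> R.
  by rewrite subr_ge0 ler_pdivrMr SE; lra.
have d0 : 0 <= C / s.+1%:R ^+ 2 by rewrite divr_ge0 ?sqr_ge0; lra.
under eq_integral do rewrite EFinD EFinM.
rewrite ge0_integralD //; last 2 first.
- by move=> w _; rewrite -EFinM lee_fin mulr_ge0 ?sqr_ge0.
- by apply: emeasurable_funM => //; exact: measurable_excess.
rewrite integral_cst // ge0_integralZl //; last 2 first.
- exact: measurable_excess.
- by move=> w _; rewrite lee_fin sqr_ge0.
rewrite [X in (_ + _ * X)%E]probability_setT mule1.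
apply: (@le_trans _ _ ((1 - 2 / s.+1%:R)%:E * (C / s%:R)%:E + (C / s.+1%:R ^+ 2)%:E)%E).
  by apply: leeD2r; apply: lee_wpmul2l.
rewrite -EFinM -EFinD lee_fin SE.
set x : R := s%:R in sR *.
(* The contraction outweighs the added term: the recursion sends [C / x] to [C / (x + 1)] minus a
   nonnegative quantity. *)
have -> : (1 - 2 / (x + 1)) * (C / x) + C / (x + 1) ^+ 2 =
   C / (x + 1) - C * (x * (x + 1) ^+ 2)^-1 by field; lra.
rewrite gerBl mulr_ge0 ?invr_ge0 ?mulr_ge0 ?sqr_ge0 //; lra.
Qed.

End SecondMoment.

(** * Passage from cubes to all times *)

Lemma powRN_eventually_le (R : realType) (c eps : R) : 0 < c -> 0 < eps ->
  exists n : nat, forall k : nat, (n <= k)%N -> k.+1%:R `^ (- c) <= eps.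
Proof.
move=> c0 e0; exists (Num.bound (eps^-1 `^ c^-1)) => k nk.
have ei : 0 < eps^-1 by rewrite invr_gt0.
have x0 : 0 < eps^-1 `^ c^-1 by exact: powR_gt0.
have xk : eps^-1 `^ c^-1 <= k.+1%:R.
  apply: (le_trans (ltW (archi_boundP (ltW x0)))).
  by rewrite ler_nat (leq_trans nk).
rewrite powRN -[leRHS]invrK lef_pV2 ?posrE ?powR_gt0 //.
have -> : eps^-1 = (eps^-1 `^ c^-1) `^ c.
  by rewrite -powRrM mulVf ?lt0r_neq0 // powRr1 // ltW.
by apply: ge0_ler_powR; rewrite ?nnegrE ?(ltW c0) ?(ltW x0).
Qed.

(** The integer cube root of [t] is written [k.+1], so that it is positive and can serve as a
    denominator. *)
Lemma cube_floor t K : (K.+1 ^ 3 <= t)%N ->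
  exists k, [/\ (K <= k)%N, (k.+1 ^ 3 <= t)%N & (t < k.+2 ^ 3)%N].
Proof.
move=> Kt; pose p k := (k.+1 ^ 3 <= t)%N.
have exp : exists k, p k by exists K.
have bound k : p k -> (k <= t)%N.
  rewrite /p => kt; apply: leq_trans kt; rewrite !expnS expn0; nia.
case: (ex_maxnP exp bound) => k pk kmax; exists k; split=> //.
  exact: kmax.
by rewrite ltnNge; apply/negP => /(kmax k.+1); lia.
Qed.

Section Interpolation.
Context {R : realType}.
Variables (rho alpha beta : R) (X : nat -> nat).
Hypotheses (beta0 : 0 <= beta) (beta1 : beta < 1 / 3) (alphab : alpha <= beta).
Hypothesis Xgrowth : forall s t, (1 <= s)%N -> (s <= t)%N ->
  (X t <= X s + (t - s))%N.

(** With [n = k.+1], the count gains at most [3 n^2 + 3 n + 1 <= 7 n^2] after time [n^3], and the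
    denominator is at least [n^3]. *)
Lemma excess_growth k t : (k.+1 ^ 3 <= t)%N -> (t < k.+2 ^ 3)%N ->
  excess rho t (X t)%:R <=
  excess rho (k.+1 ^ 3) (X (k.+1 ^ 3))%:R + 7 / k.+1%:R.
Proof.
move=> kt tk; set s := (k.+1 ^ 3)%N in kt *.
have s1 : (1 <= s)%N by rewrite expn_gt0.
have ts : (t - s <= 7 * k.+1 ^ 2)%N.
  by move: tk; rewrite /s !expnS !expn0; nia.
have := Xgrowth s1 kt; rewrite -(ler_nat R) natrD => Xle.
have kR : 1 <= k.+1%:R :> R by rewrite ler1n.
have sE : s%:R = k.+1%:R ^+ 3 :> R by rewrite natrX.
have {}ts : (t - s)%:R <= 7 * k.+1%:R ^+ 2 :> R.
  by rewrite -natrX -natrM ler_nat.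
have sR : 1 <= s%:R :> R by rewrite ler1n.
have stR : s%:R <= t%:R :> R by rewrite ler_nat.
have X0 : 0 <= (X t)%:R :> R by [].
rewrite {1}/excess ge_max; apply/andP; split.
  by rewrite addr_ge0 ?excess_ge0 // divr_ge0.
apply: (@le_trans _ _ ((X s)%:R / s%:R - rho + 7 / k.+1%:R)); last first.
  by rewrite lerD2r /excess le_max lexx orbT.
rewrite addrAC lerD2r.
apply: (@le_trans _ _ ((X t)%:R / s%:R)).
  by apply: ler_wpM2l => //; rewrite lef_pV2 ?posrE; lra.
have -> : 7 / k.+1%:R = 7 * k.+1%:R ^+ 2 / s%:R :> R by rewrite sE; field; lra.
by rewrite -mulrDl ler_wpM2r ?invr_ge0 //; lra.
Qed.

Lemma cvg_excess_interpolation :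
  (fun k : nat => k.+1%:R `^ (6 * beta) *
     excess rho (k.+1 ^ 3) (X (k.+1 ^ 3))%:R ^+ 2) @ \oo --> (0 : R) ->
  (fun t : nat => t%:R `^ alpha * excess rho t (X t)%:R) @ \oo --> (0 : R).
Proof.
move=> /cvgrPdist_le cf; apply/cvgrPdist_le => eps e0.
(* The final bound is [8 * (q * y) + 56 * (q / k.+1)], and [8 + 56 = 64]. *)
pose eta := eps / 64; have eta0 : 0 < eta by rewrite /eta; lra.
have [K1 _ HK1] : \forall k \near \oo, `|0 - k.+1%:R `^ (6 * beta) *
     excess rho (k.+1 ^ 3) (X (k.+1 ^ 3))%:R ^+ 2| <= eta ^+ 2.
  by apply: cf; rewrite exprn_gt0.
have c0 : 0 < 1 - 3 * beta by have := beta1; lra.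
have [K2 HK2] := powRN_eventually_le c0 eta0.
exists ((maxn K1 K2).+1 ^ 3)%N => // t /= Kt.
have t1 : (1 <= t)%N by apply: leq_trans Kt; rewrite expn_gt0.
have [k [Kk kt tk]] := cube_floor Kt.
rewrite sub0r normrN ger0_norm; last by rewrite mulr_ge0 ?powR_ge0 ?excess_ge0.
have kR : 1 <= k.+1%:R :> R by rewrite ler1n.
have tR : 1 <= t%:R :> R by rewrite ler1n.
set y := excess rho (k.+1 ^ 3) (X (k.+1 ^ 3))%:R.
have y0 : 0 <= y by exact: excess_ge0.
pose q : R := k.+1%:R `^ (3 * beta).
have q0 : 0 < q by apply: powR_gt0; lra.
have qy : q * y <= eta.
  have := HK1 k (leq_trans (leq_maxl _ _) Kk); rewrite /= sub0r normrN -/y.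
  rewrite ger0_norm ?mulr_ge0 ?powR_ge0 ?sqr_ge0 //.
  have -> : k.+1%:R `^ (6 * beta) = q ^+ 2.
    rewrite expr2 /q -powRD; last by rewrite pnatr_eq0 implybT.
    by congr (_ `^ _); ring.
  rewrite -exprMn ler_sqr ?nnegrE ?mulr_ge0 //; exact: ltW.
(* The growth between consecutive cubes is negligible because [3 * beta < 1]. *)
have qk : q / k.+1%:R <= eta.
  have := HK2 k (leq_trans (leq_maxr _ _) Kk).
  suff -> : k.+1%:R `^ (- (1 - 3 * beta)) = q / k.+1%:R by [].
  rewrite opprB powRD; last by rewrite pnatr_eq0 implybT.
  by rewrite powR_inv1.
(* Here [t < k.+2 ^ 3 <= 8 * k.+1 ^ 3], and [8 ^ beta <= 8]. *)
have tq : t%:R `^ alpha <= 8 * q.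
  apply: (@le_trans _ _ (t%:R `^ beta)); first exact: ler_powR.
  apply: (@le_trans _ _ ((8 * k.+1%:R `^ 3) `^ beta)).
    apply: ge0_ler_powR; rewrite ?nnegrE ?mulr_ge0 ?powR_ge0 //; try lra.
    rewrite powR_mulrn // -natrX -natrM ler_nat.
    apply: leq_trans (ltnW tk) _.
    by rewrite (_ : 8 = 2 ^ 3)%N // -expnMn leq_exp2r //; lia.
  rewrite powRM ?powR_ge0 // -powRrM -/q ler_wpM2r ?powR_ge0 //.
  rewrite -[leRHS]powRr1 //; apply: ler_powR; first by lra.
  by have := beta1; lra.
have ex0 : 0 <= excess rho t (X t)%:R by exact: excess_ge0.
have grow := excess_growth kt tk; rewrite -/y in grow.
apply: (@le_trans _ _ (8 * q * (y + 7 / k.+1%:R))).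
  by apply: ler_pM; rewrite ?powR_ge0.
have -> : 8 * q * (y + 7 / k.+1%:R) = 8 * (q * y) + 56 * (q / k.+1%:R) by ring.
move: qy qk; rewrite /eta; move: (q * y) (q / _) => u v; lra.
Qed.

End Interpolation.

(** * Almost sure convergence of the excess *)

Section AlmostSure.
Context {R : realType} {d : measure_display} {T : measurableType d}.
Variables (P : probability T R) (m : nat) (delta rho : R).
Variables (F : nat -> set (set T)) (W : nat -> nat -> T -> nat).
Variable M : nat -> T -> edge_set.
Hypotheses (m1 : (1 <= m)%N) (dm : - m%:R < delta).
Hypotheses (rho0 : 0 < rho) (rho1 : rho < 1) (hrho : h m delta rho = 0).
Hypothesis PA : pref_attachment P m delta F W.
Hypothesis GM : greedy_matching m F W M.

Lemma ae_cvg_excess (alpha : R) : alpha < 1 / 3 ->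
  {ae P, forall w : T, (fun t : nat => t%:R `^ alpha *
     excess rho t (num_uncovered (M t w) t)%:R) @ \oo --> (0 : R)}.
Proof.
(* A negative exponent is raised to [0], which only enlarges [t ^ alpha] for [t >= 1] and makes the
   power with exponent [beta] monotone. *)
move=> alpha1; pose beta := Num.max 0 alpha.
have b0 : 0 <= beta by rewrite le_max lexx.
have b1 : beta < 1 / 3 by rewrite gt_max alpha1; lra.
have ab : alpha <= beta by rewrite le_max lexx orbT.
pose C := drift_const m delta.
have C0 : 0 <= C by have := drift_const_ge m1 dm; rewrite -/C; lra.
(* The second moment at time [k.+1 ^ 3] is at most [C / k.+1 ^ 3], so the weighted terms have
   exponent [6 * beta - 3 = - (a + 1)]; [a > 0] amounts to [beta < 1/3]. *)
pose a := 2 - 6 * beta; have a0 : 0 < a by rewrite /a; lra.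
pose y k w : R := excess rho (k.+1 ^ 3) (num_uncovered (M (k.+1 ^ 3) w) (k.+1 ^ 3))%:R.
have cube1 k : (1 <= k.+1 ^ 3)%N by rewrite expn_gt0.
have : {ae P, forall w, (fun k => k.+1%:R `^ (6 * beta) * y k w ^+ 2) @ \oo
    --> (0 : R)}.
  apply: (@ae_cvg0_summable _ _ _ P _ (fun k => C * k.+1%:R `^ (- (a + 1)))
    (C * (1 + a^-1))) => [k|k w|k|n].
  - exact: (measurable_fun_discrete (fun S => (k.+1%:R `^ (6 * beta) *
      excess rho (k.+1 ^ 3) (num_uncovered S (k.+1 ^ 3))%:R ^+ 2)%:E)
      (matching_discrete_meas PA GM (cube1 k))).
  - by rewrite mulr_ge0 ?powR_ge0 ?sqr_ge0.
  - under eq_integral do rewrite EFinM.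
    rewrite ge0_integralZl ?lee_fin ?powR_ge0 //; last 2 first.
    + exact: (measurable_excess rho PA GM (cube1 k)).
    + by move=> w _; rewrite lee_fin sqr_ge0.
    apply: (@le_trans _ _
        ((k.+1%:R `^ (6 * beta))%:E * (C / (k.+1 ^ 3)%:R)%:E)%E).
      apply: lee_wpmul2l; first by rewrite lee_fin powR_ge0.
      exact: (second_moment_le m1 dm rho0 rho1 hrho PA GM (cube1 k)).
    rewrite -EFinM lee_fin mulrCA ler_wpM2l //.
    have -> : - (a + 1) = 6 * beta + - 3 by rewrite /a; ring.
    rewrite powRD; last by rewrite pnatr_eq0 implybT.
    by rewrite powRN powR_mulrn // natrX.
  - by rewrite -mulr_sumr ler_wpM2l //; exact: sum_powR_le.
apply: filterS => w cw.
apply: (cvg_excess_interpolation b0 b1 ab _ cw) => s t s1 st.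
case: GM => _ M1 Mstep.
exact: (@num_uncovered_growth m _ (M^~ w) (M1 w) (Mstep w) s t s1 st).
Qed.

End AlmostSure.

(** * Rate of convergence and size of the matchings *)

Theorem theorem2p5 (R : realType) (m : nat) (delta : R)
    (m_ge1 : (1 <= m)%N) (delta_gt : - m%:R < delta) :
  exists2 rho : R,
    unique (fun z : R => 0 < z < 1 /\ h m delta z = 0) rho &
    forall (d : measure_display) (T : measurableType d) (P : probability T R)
      (F : nat -> set (set T)) (W : nat -> nat -> T -> nat)
      (M : nat -> T -> edge_set),
      pref_attachment P m delta F W ->
      greedy_matching m F W M ->
      (forall alpha : R, alpha < 1 / 3 ->
        {ae P, forall w : T,
          (fun t : nat => t%:R `^ alpha *
             Num.max 0 ((num_uncovered (M t w) t)%:R / t%:R - rho)) @ \oo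
          --> (0 : R)}) /\
      {ae P, forall w : T,
        [/\ forall t : nat, (1 <= t)%N ->
              is_matching (pa_graph m (fun s j => W s j w) t 0) (M t w),
            forall t : nat, (1 <= t)%N -> (M t w `<=` M t.+1 w)%fset &
            exists eps : nat -> R,
              (eps @ \oo --> (0 : R)) /\
              forall t : nat, (1 <= t)%N ->
                (1 - eps t) * ((1 - rho) * t%:R / 2) <= (#|` M t w|)%:R /\
                (1 - eps t) * ((1 - rho) * t%:R) <= (num_covered (M t w) t)%:R]}.
Proof.
have [rho rhoU] := h_unique_root m_ge1 delta_gt.
exists rho => // d T P F W M PA GM.
have [[/andP[rho0 rho1] hrho] _] := rhoU.
have excess0 := ae_cvg_excess m_ge1 delta_gt rho0 rho1 hrho PA GM.
split; first exact: excess0.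
(* The exponent [0] already makes the excess vanish in the limit, which is all that the size of the
   matching requires. *)
have := excess0 0 ltac:(lra); apply: filterS => w cw.
case: GM => _ M1 Mstep; split.
- exact: (@greedy_is_matching m _ (M^~ w) (M1 w) (Mstep w)).
- exact: (@greedy_subset m _ (M^~ w) (Mstep w)).
(* With this choice [(1 - eps t) * (1 - rho)] is [1 - rho] minus the excess, hence at most the
   covered fraction. The factor [t ^ 0], equal to [1], keeps the form of the convergence [cw]. *)
exists (fun t => (1 - rho)^-1 * (t%:R `^ 0 *
  excess rho t (num_uncovered (M t w) t)%:R)); split.
  by have := cvgM (cvg_cst (1 - rho)^-1) cw; rewrite mulr0; exact.
move=> t t1; rewrite powRr0 mul1r.
have tR : 1 <= t%:R :> R by rewrite ler1n.
set x := (num_uncovered (M t w) t)%:R.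
have cE : (num_covered (M t w) t)%:R = t%:R - x :> R.
  by apply/eqP; rewrite eq_sym subr_eq -natrD num_covered_uncovered.
have main : (1 - (1 - rho)^-1 * excess rho t x) * ((1 - rho) * t%:R) <=
    (num_covered (M t w) t)%:R.
  have -> : (1 - (1 - rho)^-1 * excess rho t x) * ((1 - rho) * t%:R) =
      (1 - rho - excess rho t x) * t%:R by field; lra.
  rewrite cE.
  have -> : t%:R - x = (1 - x / t%:R) * t%:R by field; lra.
  have : x / t%:R - rho <= excess rho t x by rewrite /excess le_max lexx orbT.
  by move=> ex; rewrite ler_wpM2r //; lra.
split=> //; rewrite mulrA ler_pdivrMr //; apply: le_trans main _.
rewrite (@num_covered_card m _ (M^~ w) (M1 w) (Mstep w)) //.
by rewrite -muln2 natrM.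
Qed.
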